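(* Let $(\Gamma,P)$, with $\Gamma=(N,K,C,T)$ and $P=\{P_1,\dots,P_A\}$, be a generalized highway problem with a coalitional structure, $(N,c,P)$ its associated game with a coalitional structure, and $M=\{1,\dots,A\}$ the set of a priori unions. Let $a^*$ be the alliance resulting from merging the unions $\{1,\dots,a\}\subseteq M$ (with $2\le a\le A$), that is $P_{a^*}=\bigcup_{\alpha=1}^aP_\alpha$, let $P^*=\{P_{a^*},P_{a+1},\dots,P_A\}$, and let $(N,c,P^* )$ be the modified game with a coalitional structure. Let $K^{se}_{P^*}$ be the set of sections $t\in K$ that are used by at least two unions of $P$ but by exactly one union of $P^*$. If $K^{se}_{P^*}=\emptyset$, then $$\mathcal{T}_{a^*}(N,c,P^* )\le\sum_{\alpha\in\{1,\dots,a\}}\mathcal{T}_\alpha(N,c,P),$$ where the inequality is strict if and only if the alliance shares the use of some highway section (i.e. some section is used both by $P_{a^*}$ and by a union outside the alliance) and there is a section used by at least two unions of the alliance.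
   Context: A generalized highway problem is a 4-tuple $\Gamma=(N,K,C,T)$ where $N$ is a finite set of agents, $K$ is a finite nonempty ordered set of sections, $C:K\to\mathbb{R}_+$ gives the cost of each section, and $T:N\to 2^K\setminus\{\emptyset\}$ gives the set of sections used by each agent, with $\bigcup_{i\in N}T(i)=K$. For $S\subseteq N$ put $T(S)=\bigcup_{i\in S}T(i)$, and for $K'\subseteq K$ put $C(K')=\sum_{t\in K'}C(t)$. The associated cost game is $(N,c)$ with $c(S)=C(T(S))$; it is concave. If $P=\{P_1,\dots,P_A\}$ is a partition of $N$ (into a priori unions), $(\Gamma,P)$ is a generalized highway problem with a coalitional structure and $(N,c,P)$ its associated game with a coalitional structure. A union $P_b$ uses section $t$ if $t\in T(P_b)$; the unions of the alliance are $P_1,\dots,P_a$. With $M=\{1,\dots,A\}$, the quotient game is $(M,c_P)$ with $c_P(H)=c(\bigcup_{a\in H}P_a)$, $H\subseteq M$. Tijs value of a concave cost game $(N,c)$: $\tau_i(N,c)=m_i+\alpha(M_i-m_i)$, where $M_i=c(N)-c(N\setminus\{i\})$, $m_i=\min_{S\subseteq N,\,i\in S}\{c(S)-\sum_{j\in S\setminus\{i\}}M_j\}$, and $\alpha\in[0,1]$ is such that $\sum_{i\in N}\tau_i(N,c)=c(N)$. Coalitional Tijs value of $(N,c,P)$ with $(N,c)$ concave: for $i\in P_a$, $\mathcal{T}_i(N,c,P)=m_i+\alpha_a(M_i-m_i)$, where $M_i=c(N)-c(N\setminus\{i\})$, $m_i=\min_{S\in P(a),\,i\in S}\{c(S)-\sum_{j\in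 S\setminus\{i\}}M_j\}$, $P(a)=\{\bigcup_{l\in L}P_l\cup T'\mid L\subseteq M\setminus\{a\},\,T'\subseteq P_a\}$, and $\alpha_a\in[0,1]$ is such that $\sum_{i\in P_a}\mathcal{T}_i(N,c,P)=\tau_a(M,c_P)$. The total payment of union $b$ is $\mathcal{T}_b(N,c,P)=\sum_{i\in P_b}\mathcal{T}_i(N,c,P)=\tau_b(M,c_P)$ (and likewise for $P^*$).
   Formalization: The inequality is proved for all nonnegative section costs; the strictness equivalence is stated only when every section has positive cost, since it fails with zero costs (three singleton unions all using one section of cost 0, a=2). *)

(* Defs.v *)
From HB Require Import structures.
From mathcomp Require Import all_boot all_order all_algebra.
From mathcomp Require Import reals.
From mathcomp Require classical_sets.

Set Implicit Arguments.
Unset Strict Implicit.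
Unset Printing Implicit Defensive.

Import Order.TTheory GRing.Theory Num.Theory.
Local Open Scope ring_scope.

(* The order on the sections is part of the data but plays no role in the
   costs.  Sections of cost 0 are allowed. *)
Record highway (R : realType) (N : finType) (d : Order.disp_t)
    (K : finOrderType d) := Highway {
  section_cost : K -> R;
  sections_used : N -> {set K};
  section_cost_ge0 : forall t, 0 <= section_cost t;
  sections_used_neq0 : forall i, sections_used i != set0;
  sections_used_cover : \bigcup_(i : N) sections_used i = [set: K];
  sections_nonempty : (0 < #|K|)%N
}.

Section Highway.
Variables (R : realType) (N : finType) (d : Order.disp_t) (K : finOrderType d).
Variable G : highway R N K.

Definition coalition_sections (S : {set N}) : {set K} :=
  \bigcup_(i in S) sections_used G i.

Definition highway_game (S : {set N}) : R :=
  \sum_(t in coalition_sections S) section_cost G t.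

Definition union_uses (S : {set N}) (t : K) : bool :=
  t \in coalition_sections S.

Definition unions_using (M : finType) (P : M -> {set N}) (t : K) : {set M} :=
  [set b | union_uses (P b) t].

(* The set K^se_{P*}: here P and P* are families of unions, whose index types
   M and M' may differ. *)
Definition newly_exclusive_sections (M M' : finType)
    (P : M -> {set N}) (P' : M' -> {set N}) : {set K} :=
  [set t | (2 <= #|unions_using P t|)%N && (#|unions_using P' t| == 1%N)].

End Highway.

(* A system of a priori unions: P enumerates the blocks of a partition of N
   without repetition. *)
Definition coalitional_structure (N M : finType) (P : M -> {set N}) : Prop :=
  injective P /\ partition (P @: [set: M]) [set: N].

Section Tijs.
Variables (R : realType) (N : finType) (c : {set N} -> R).

Definition separable_cost (i : N) : R := c [set: N] - c ([set: N] :\ i).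

Definition remainder_cost (i : N) (S : {set N}) : R :=
  c S - \sum_(j in S :\ i) separable_cost j.

(* Minimum of the remainder over the coalitions of F that contain i.  The big
   operator needs a starting value; in both uses below [set i] belongs to F, so
   starting from it does not change the minimum. *)
Definition min_remainder (F : {set {set N}}) (i : N) : R :=
  \big[Num.min / remainder_cost i [set i]]_(S in F | i \in S)
    remainder_cost i S.

(* "The" weight alpha in [0, 1] for which the payments m_i + alpha (M_i - m_i)
   of the members of B add up to v.  If every M_i = m_i the choice of alpha is
   immaterial; if there is no such alpha the value is 0. *)
Definition compromise_weight (B : {set N}) (m : N -> R) (v : R) : R :=
  classical_sets.xget 0 (fun alpha : R =>
    0 <= alpha <= 1 /\
    \sum_(i in B) (m i + alpha * (separable_cost i - m i)) = v).

Definition compromise (F : {set {set N}}) (B : {set N}) (v : R) (i : N) : R :=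
  let m := min_remainder F in
  m i + compromise_weight B m v * (separable_cost i - m i).

Definition tijs (i : N) : R := compromise [set: {set N}] [set: N] (c [set: N]) i.

End Tijs.

Section CoalitionalTijs.
Variables (R : realType) (N M : finType) (c : {set N} -> R) (P : M -> {set N}).

Definition quotient_game (H : {set M}) : R := c (\bigcup_(a in H) P a).

Definition compatible_coalitions (a : M) : {set {set N}} :=
  [set (\bigcup_(l in (L : {set M})) P l) :|: T'
     | L in powerset ([set: M] :\ a), T' in powerset (P a)].

(* The coalitional Tijs value of a member i of the union P a; the index a is
   determined by i, and the value is only meaningful for i \in P a. *)
Definition coalitional_tijs (a : M) (i : N) : R :=
  compromise c (compatible_coalitions a) (P a) (tijs quotient_game a) i.

Definition union_payment (a : M) : R :=
  \sum_(i in P a) coalitional_tijs a i.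

End CoalitionalTijs.

(* The unions are indexed from 0, so that the alliance consists of the unions
   b < a.  In the modified structure None stands for the merged union a* and
   Some b for the union b outside the alliance. *)
Definition alliance (N : finType) (A : nat) (P : 'I_A -> {set N}) (a : nat)
  : {set N} := \bigcup_(b < A | (b < a)%N) P b.

Definition merged (N : finType) (A : nat) (P : 'I_A -> {set N}) (a : nat)
    (u : option {b : 'I_A | (a <= b)%N}) : {set N} :=
  if u is Some b then P (val b) else alliance P a.
Arguments merged {N A} P a u.

(* Main.v *)
(* Every game here is a coverage game: c(S) is the cost of the sections used by
   S.  In such a game m_i = c({i}), and M_i is the cost of the sections used by
   i alone, so the Tijs value is M_i + be (c({i}) - M_i), where be is the
   nonseparable cost D = c(N) - sum M_i divided by W = sum (c({i}) - M_i).  The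
   quotient game is again a coverage game, and its Tijs value lies between the
   bounds that make the weight alpha_a exist, so union payments are the Tijs
   values of the quotient game.

   When no section becomes exclusive, merging preserves D, the separable cost of
   the alliance, and the part Y of W due to the outsiders; it can only lower the
   part X due to the alliance, to X'.  So the alliance pays D X' / (X' + Y)
   instead of D X / (X + Y) on top of its separable cost. *)

Require Import Defs.
From HB Require Import structures.
From mathcomp Require Import all_boot all_order all_algebra.
From mathcomp Require Import reals.
From mathcomp Require Import boolp.
From mathcomp Require classical_sets.
From mathcomp Require Import lra ring.

Set Implicit Arguments.
Unset Strict Implicit.
Unset Printing Implicit Defensive.

Import Order.TTheory GRing.Theory Num.Theory.
Local Open Scope ring_scope.

(** * Compromise values *)

(** The total payment is affine in the weight, equal to the sum of the [m i] at 0 and to the sum of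
    the separable costs at 1, so it takes every value in between. *)
Lemma compromise_weightP (R : realType) (N : finType) (c : {set N} -> R)
    (B : {set N}) (m : N -> R) (v : R) :
  \sum_(i in B) separable_cost c i <= v <= \sum_(i in B) m i ->
  0 <= compromise_weight c B m v <= 1 /\
  \sum_(i in B) (m i + compromise_weight c B m v * (separable_cost c i - m i))
    = v.
Proof.
move=> /andP[]; set s := \sum_(i in B) _; set S := \sum_(i in B) m i => sv vS.
rewrite /compromise_weight.
apply: (@classical_sets.xgetPex R 0 (fun al : R => 0 <= al <= 1 /\
  \sum_(i in B) (m i + al * (separable_cost c i - m i)) = v)).
have sumE (al : R) :
    \sum_(i in B) (m i + al * (separable_cost c i - m i)) = S + al * (s - S).
  by rewrite big_split -mulr_sumr sumrB.
(* If the two bounds agree, every weight works, and the quotient taken below would have denominator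
   0. *)
have [eS|neS] := eqVneq s S.
  by exists 0; split; [by rewrite lexx ler01 | rewrite sumE; lra].
have sS : 0 < S - s by rewrite subr_gt0 lt_neqAle neS (le_trans sv).
exists ((S - v) / (S - s)); split; last by rewrite sumE; field; lra.
by rewrite divr_ge0 ?ler_pdivrMr//=; lra.
Qed.

(** * Coverage games *)

(** The highway game with only [T] and [w] kept, so that its quotient games are again of this
    form. *)
Definition coverage_cost (R : realType) (N K : finType) (T : N -> {set K})
    (w : K -> R) (S : {set N}) : R :=
  \sum_(t in \bigcup_(i in S) T i) w t.

Definition users (N K : finType) (T : N -> {set K}) (t : K) : {set N} :=
  [set i | t \in T i].

Lemma sum_eq_set1 (I : finType) (U S : {set I}) :
  (\sum_(j in S) (U == [set j]) = (#|U| == 1) && (U \subset S))%N.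
Proof.
have [/cards1P[x ->]|U1] /= := boolP (#|U| == 1)%N; last first.
  by rewrite big1// => j _; apply/eqP; rewrite eqb0; apply: contraNneq U1 => ->;
    rewrite cards1.
rewrite sub1set; have [xS|xS] := boolP (x \in S).
  rewrite (bigD1 x)//= eqxx big1// => j /andP[_ jx].
  by rewrite (inj_eq set1_inj) eq_sym (negPf jx).
rewrite big1// => j jS; rewrite (inj_eq set1_inj).
by apply/eqP; rewrite eqb0; apply: contraNneq xS => ->.
Qed.

Lemma ltr_sum_ex (R : numDomainType) (I : finType) (F G : I -> R) (i : I) :
  (forall j, F j <= G j) -> F i < G i -> \sum_j F j < \sum_j G j.
Proof.
move=> FG FGi; rewrite (bigD1 i)// [ltRHS](bigD1 i)//=.
by apply: ltr_leD => //; apply: ler_sum.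
Qed.

Section Coverage.
Variables (R : realType) (N K : finType) (T : N -> {set K}) (w : K -> R).
Hypothesis w_ge0 : forall t, 0 <= w t.

Local Notation c := (coverage_cost T w).
Local Notation U := (users T).
Local Notation E := (separable_cost c).

Lemma coverage_costE (S : {set N}) :
  c S = \sum_t w t *+ (U t :&: S != set0).
Proof.
rewrite /coverage_cost big_mkcond; apply: eq_bigr => t _.
suff -> : (t \in \bigcup_(i in S) T i) = (U t :&: S != set0).
  by case: ifP.
apply/bigcupP/set0Pn => -[i].
  by move=> iS ti; exists i; rewrite !inE ti.
by rewrite !inE => /andP[ti iS]; exists i.
Qed.

Lemma coverage_cost1 (i : N) : c [set i] = \sum_t w t *+ (i \in U t).
Proof.
rewrite coverage_costE; apply: eq_bigr => t _; congr (_ *+ nat_of_bool _).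
by rewrite setI_eq0 disjoint_sym disjoints1 negbK.
Qed.

Lemma coverage_sum1 (S : {set N}) :
  \sum_(i in S) c [set i] = \sum_t w t *+ #|U t :&: S|.
Proof.
under eq_bigr do rewrite coverage_cost1.
rewrite exchange_big; apply: eq_bigr => t _ /=.
rewrite sumrMnr; congr (_ *+ _).
rewrite -sum1_card big_mkcond [RHS]big_mkcond; apply: eq_bigr => i _.
by rewrite in_setI andbC; case: (i \in S); case: (i \in U t).
Qed.

Lemma separable_coverageE (i : N) :
  E i = \sum_t w t *+ (U t == [set i]).
Proof.
rewrite /separable_cost !coverage_costE -sumrB; apply: eq_bigr => t _.
suff -> : (U t :&: setT != set0
    = (U t == [set i]) + (U t :&: (setT :\ i) != set0) :> nat)%N.
  by rewrite mulrnDr addrK.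
rewrite setIT setTD; have [->|Ui] := eqVneq (U t) [set i].
  by rewrite setICr eqxx -card_gt0 cards1.
rewrite setI_eq0 disjoints_subset setCK subset1 (negPf Ui) /=.
by case: eqP.
Qed.

(** Compared section by section: a section whose only user lies in [S] is absent from [c S'], by
    disjointness, and is paid once in [c (S' :|: S)]. *)
Lemma coverage_add_separable (S' S : {set N}) :
  [disjoint S' & S] -> c S' + \sum_(j in S) E j <= c (S' :|: S).
Proof.
move=> dS.
under eq_bigr do rewrite separable_coverageE.
rewrite exchange_big !coverage_costE -big_split /=; apply: ler_sum => t _.
rewrite sumrMnr -mulrnDr ler_wpMn2l// sum_eq_set1.
have [/andP[/cards1P[x ->]]|_] := boolP ((_ == 1)%N && _); last first.
  rewrite addn0 setIUr; case: eqP => // /eqP /set0Pn[x xU].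
  by have -> : U t :&: S' :|: U t :&: S != set0 by
    apply/set0Pn; exists x; rewrite inE xU.
rewrite sub1set => xS.
have xS' : x \notin S' by rewrite (disjointFl dS).
have /eqP -> : [set x] :&: S' == set0 by rewrite setI_eq0 disjoints1.
rewrite eqxx add0n lt0b; apply/set0Pn; exists x.
by rewrite !inE eqxx xS orbT.
Qed.

Lemma coverage_cost0 : c set0 = 0.
Proof. by rewrite /coverage_cost !big_set0. Qed.

Lemma separable_le (i : N) : E i <= c [set i].
Proof.
have := @coverage_add_separable set0 [set i].
by rewrite coverage_cost0 set0U big_set1 add0r -setI_eq0 set0I eqxx; apply.
Qed.

Lemma separable_lt (i : N) (t : K) :
  0 < w t -> i \in U t -> U t != [set i] -> E i < c [set i].
Proof.
move=> wt iU Ut; rewrite separable_coverageE coverage_cost1.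
apply: (@ltr_sum_ex _ _ _ _ t) => [t'|]; last first.
  by rewrite iU (negPf Ut) mulr0n mulr1n.
by rewrite ler_wpMn2l//; case: eqP => [->|//]; rewrite set11.
Qed.

Lemma coverage_le_sum (S : {set N}) : c S <= \sum_(i in S) c [set i].
Proof.
rewrite coverage_sum1 coverage_costE; apply: ler_sum => t _.
by rewrite ler_wpMn2l// -card_gt0; case: #|_|.
Qed.

Lemma coverage_lt_sum (S : {set N}) (t : K) :
  0 < w t -> (2 <= #|U t :&: S|)%N -> c S < \sum_(i in S) c [set i].
Proof.
move=> wt U2; rewrite coverage_sum1 coverage_costE.
apply: (@ltr_sum_ex _ _ _ _ t) => [t'|].
  by rewrite ler_wpMn2l// -card_gt0; case: #|_|.
by rewrite ltr_pMn2l// -card_gt0 (ltnW U2).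
Qed.

(** By [coverage_add_separable] for [[set i]] and [S :\ i], no remainder is below that of [[set i]],
    whatever [F] is. So the Tijs value and its coalitional version share the same [m]. *)
Lemma min_remainder_coverage (F : {set {set N}}) :
  min_remainder c F = fun i => c [set i].
Proof.
apply: funext => i.
have rem1 : remainder_cost c i [set i] = c [set i].
  by rewrite /remainder_cost setDv big_set0 subr0.
rewrite /min_remainder rem1; apply: bigmin_eq_id => S /andP[_ iS].
rewrite /remainder_cost lerBrDr -[in leRHS](setD1K iS).
by apply: coverage_add_separable; rewrite disjoints1 setD11.
Qed.

Lemma tijs_coverage : exists be : R,
  [/\ 0 <= be <= 1,
      be * \sum_i (c [set i] - E i) = c setT - \sum_i E i &
      forall i, tijs c i = E i + be * (c [set i] - E i)].
Proof.
have inT (f : N -> R) : \sum_(i in [set: N]) f i = \sum_i f i.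
  by apply: eq_bigl => i; rewrite inE.
have := @compromise_weightP _ _ c [set: N] (fun i => c [set i]) (c setT).
have := @coverage_add_separable set0 setT.
rewrite coverage_cost0 set0U -setI_eq0 set0I eqxx add0r => -> //.
rewrite coverage_le_sum => /(_ isT).
rewrite -(min_remainder_coverage setT) inT.
case; set al := compromise_weight _ _ _ _ => al01 eal.
(* The weight is now measured from the separable cost upwards. *)
exists (1 - al); split; first by lra.
  rewrite -eal -sumrB mulr_sumr; apply: eq_bigr => i _; ring.
move=> i; rewrite /tijs /compromise -/al min_remainder_coverage; ring.
Qed.

Lemma tijs_coverage_bounds (i : N) : E i <= tijs c i <= c [set i].
Proof.
have [be [/andP[be0 be1] _ ->]] := tijs_coverage.
have := separable_le i; rewrite -subr_ge0 => d0.
by apply/andP; split; nra.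
Qed.

End Coverage.

(** * Quotient games and union payments *)

Section Quotient.
Variables (R : realType) (N K M : finType) (T : N -> {set K}) (w : K -> R).
Variable P : M -> {set N}.
Hypothesis w_ge0 : forall t, 0 <= w t.
Hypothesis disjP : forall a b, a != b -> [disjoint P a & P b].

Local Notation c := (coverage_cost T w).
Local Notation TP := (fun b => \bigcup_(i in P b) T i).

Lemma quotient_coverage : quotient_game c P = coverage_cost TP w.
Proof.
apply: funext => H; apply: eq_bigl => t.
apply/bigcupP/bigcupP => [[i /bigcupP[b bH ib] ti]|[b bH]].
  by exists b => //; apply/bigcupP; exists i.
by case/bigcupP => i ib ti; exists i => //; apply/bigcupP; exists b.
Qed.

(** A section whose only user is in [P a] is used by no other union, since unions are disjoint. *)
Lemma sum_separable_le_quotient (a : M) :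
  \sum_(i in P a) separable_cost c i <= separable_cost (quotient_game c P) a.
Proof.
rewrite quotient_coverage separable_coverageE.
under eq_bigr do rewrite separable_coverageE.
rewrite exchange_big; apply: ler_sum => t _ /=.
rewrite sumrMnr ler_wpMn2l// sum_eq_set1.
have [/andP[/cards1P[i Ui]]|//] := boolP ((_ == 1)%N && _).
rewrite Ui sub1set lt0b => ia; apply/eqP/setP => b; rewrite !inE.
have tT j : (t \in T j) = (j == i) by have /setP/(_ j) := Ui; rewrite !inE.
apply/bigcupP/eqP => [[j jb]|->]; last by exists i; rewrite ?tT.
rewrite tT => /eqP ji; apply/eqP; apply: contraTT ia => ba.
by rewrite -ji (disjointFr (disjP ba)).
Qed.

(** This is the defining equation of the weight, so only its existence is at stake: the Tijs value
    of [a] lies between the separable and the stand-alone cost of the union, which in turn lie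
    between the sums of those of its members. *)
Lemma union_payment_tijs (a : M) :
  union_payment c P a = tijs (quotient_game c P) a.
Proof.
rewrite /union_payment /coalitional_tijs /compromise.
apply: (proj2 (compromise_weightP _)); rewrite min_remainder_coverage//.
have /andP[lo hi] : separable_cost (quotient_game c P) a
    <= tijs (quotient_game c P) a <= quotient_game c P [set a].
  by rewrite quotient_coverage; exact: tijs_coverage_bounds.
rewrite (le_trans (sum_separable_le_quotient a))//= (le_trans hi)//.
by rewrite /quotient_game big_set1 coverage_le_sum.
Qed.

End Quotient.

(** * Merging *)

Lemma sum_option_sig (V : nmodType) (I : finType) (Q : pred I)
    (f : option {i : I | Q i} -> V) (g : I -> V) :
  (forall j, f (Some j) = g (val j)) ->
  \sum_u f u = f None + \sum_(i | Q i) g i.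
Proof.
move=> fg; rewrite (bigD1 None)//=; congr (_ + _).
rewrite (reindex_omap Some id) => [|[j|]//] /=.
rewrite [RHS](reindex_omap (val : {i | Q i} -> I) insub) => [|i Qi]; last first.
  by rewrite insubT.
apply: eq_big => [j|j _]; last exact: fg.
by rewrite /= valK !eqxx (valP j).
Qed.

(* [X] and [Y] are the nonseparable costs inside and outside the alliance, [D]
   the nonseparable cost to be split, [be] the fraction of it paid per unit of
   individual nonseparable cost; primes refer to the merged structure. *)
Lemma nonseparable_share_merge (R : realType) (be be' X X' Y D : R) :
  0 <= be -> 0 <= be' -> 0 <= X' -> X' <= X -> 0 <= Y ->
  be * (X + Y) = D -> be' * (X' + Y) = D ->
  [/\ be' * X' <= be * X,
      X' = X -> be' * X' = be * X &
      X' < X -> 0 < Y -> 0 < D -> be' * X' < be * X].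
Proof.
move=> be0 be'0 X'0 X'X Y0 eD eD'; split.
(* If the rate does not fall, the outsiders pay at least as much out of the fixed [D]; if it falls,
   both factors decrease. *)
- have [le|lt] := lerP be be'.
    have : 0 <= (be' - be) * Y by rewrite mulr_ge0 ?subr_ge0.
    by rewrite mulrBl; move: eD eD'; rewrite !mulrDr; lra.
  by rewrite ler_pM// ltW.
- move=> eX; move: eD'; rewrite -eD eX => /eqP.
  (* Either the rates agree or [X + Y = 0], which forces [X = 0]. *)
  rewrite -subr_eq0 -mulrBl mulf_eq0.
  case/orP => [|/eqP] ?; first by congr (_ * _); lra.
  by rewrite (_ : X = 0) ?mulr0//; lra.
- move=> lt Yp Dp; have [le|bb] := lerP be' be.
    have bep : 0 < be.
      rewrite lt_neqAle be0 andbT; apply: contraTneq Dp => be_0.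
      by rewrite -eD -be_0 mul0r ltxx.
    by rewrite (le_lt_trans (ler_wpM2r X'0 le))// ltr_pM2l.
  have : 0 < (be' - be) * Y by rewrite mulr_gt0 ?subr_gt0.
  by rewrite mulrBl; move: eD eD'; rewrite !mulrDr; lra.
Qed.

Section Merge.
Variables (R : realType) (N K : finType) (T : N -> {set K}) (w : K -> R).
Hypothesis w_ge0 : forall t, 0 <= w t.
Variables (A : nat) (P : 'I_A -> {set N}) (a : nat).

Local Notation c := (coverage_cost T w).
Local Notation TP := (fun b => \bigcup_(i in P b) T i).
Local Notation TQ := (fun u => \bigcup_(i in merged P a u) T i).
Local Notation q := (quotient_game c P).
Local Notation q' := (quotient_game c (merged P a)).
Local Notation L := [set b : 'I_A | (b < a)%N].

Lemma mem_users_merged_None (t : K) :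
  (None \in users TQ t) = (users TP t :&: L != set0).
Proof.
rewrite inE; apply/bigcupP/set0Pn => [[i /bigcupP[b ba ib] ti]|[b]].
  by exists b; rewrite !inE ba andbT; apply/bigcupP; exists i.
rewrite !inE => /andP[/bigcupP[i ib ti] ba].
by exists i => //; apply/bigcupP; exists b.
Qed.

Lemma mem_users_merged_Some (t : K) b :
  (Some b \in users TQ t) = (val b \in users TP t).
Proof. by rewrite !inE. Qed.

Lemma quotient_merged_None : q' [set None] = q L.
Proof.
rewrite /quotient_game big_set1 /= /alliance; congr (c _).
by apply: eq_bigl => b; rewrite inE.
Qed.

Lemma quotient_merged_Some b : q' [set Some b] = q [set val b].
Proof. by rewrite /quotient_game !big_set1. Qed.

Lemma quotient_mergedT : q' setT = q setT.
Proof.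
rewrite /quotient_game; congr (c _); apply/setP => i.
apply/bigcupP/bigcupP => [[[b _ ib|_ /bigcupP[b _ ib]]]|[b _ ib]].
- by exists (val b).
- by exists b.
have [ba|ab] := ltnP b a; last by exists (Some (exist _ b ab)).
by exists None => //; apply/bigcupP; exists b.
Qed.

Lemma separable_merged_Some b :
  separable_cost q' (Some b) = separable_cost q (val b).
Proof.
rewrite !quotient_coverage !separable_coverageE; apply: eq_bigr => t _.
congr (_ *+ nat_of_bool _); apply/eqP/eqP => Ut; apply/setP.
  move=> b'; rewrite in_set1; have [ab'|b'a] := leqP a b'.
    have -> : b' = val (exist (fun b : 'I_A => (a <= b)%N) b' ab') by [].
    by rewrite -mem_users_merged_Some Ut in_set1 (inj_eq Some_inj)
      (inj_eq val_inj).
  have -> : (b' == val b) = false.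
    by apply: contraTF b'a => /eqP ->; rewrite -leqNgt (valP b).
  apply: contraFF (in_set1 None (Some b)) => b'U.
  rewrite -Ut mem_users_merged_None; apply/set0Pn; exists b'.
  by rewrite inE b'U inE.
case=> [b'|]; rewrite in_set1; last first.
  rewrite mem_users_merged_None Ut setI_eq0 disjoints1 inE -leqNgt.
  by rewrite (valP b).
by rewrite mem_users_merged_Some Ut in_set1 (inj_eq Some_inj) (inj_eq val_inj).
Qed.

Hypothesis no_newly_exclusive :
  forall t, (2 <= #|users TP t|)%N -> #|users TQ t| != 1%N.

(** The hypothesis enters here: a section exclusive to the merged union has a single user in [P], as
    it would otherwise be newly exclusive. *)
Lemma separable_merged_None :
  separable_cost q' None = \sum_(b in L) separable_cost q b.
Proof.
rewrite !quotient_coverage separable_coverageE.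
under [RHS]eq_bigr do rewrite separable_coverageE.
rewrite exchange_big; apply: eq_bigr => t _ /=.
rewrite sumrMnr; congr (_ *+ _); rewrite sum_eq_set1; congr nat_of_bool.
apply/eqP/andP => [Ut|[/cards1P[b Ub]]].
  have NU : users TP t :&: L != set0.
    by rewrite -mem_users_merged_None Ut in_set1.
  have U1 : #|users TP t| == 1%N.
    have := @no_newly_exclusive t; rewrite Ut cards1 eqxx.
    case: ltnP => [_ /(_ isT)//|+ _].
    case/set0Pn: NU => b; rewrite inE => /andP[bU _].
    by rewrite eqn_leq => -> /=; apply/card_gt0P; exists b.
  split=> //; case/cards1P: U1 NU => b ->.
  by rewrite setI_eq0 disjoints1 negbK sub1set.
rewrite Ub sub1set inE => ba; apply/setP => -[b'|]; rewrite in_set1.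
  rewrite mem_users_merged_Some Ub in_set1; apply: contraTF ba => /eqP <-.
  by rewrite -leqNgt (valP b').
by rewrite mem_users_merged_None Ub setI_eq0 disjoints1 inE ba.
Qed.

(** Such a section is not exclusive to the merged union, so the merged structure has a second user
    of it, an outsider. *)
Lemma shared_in_alliance (t : K) :
  (2 <= #|users TP t :&: L|)%N ->
  exists2 b : 'I_A, (a <= b)%N & b \in users TP t.
Proof.
move=> U2; have NU : None \in users TQ t.
  by rewrite mem_users_merged_None -card_gt0 (leq_trans _ U2).
have := no_newly_exclusive (leq_trans U2 (subset_leq_card (subsetIl _ _))).
rewrite (cardsD1 None) NU eqSS cards_eq0 => /set0Pn[[b|]]; last by rewrite !inE.
rewrite in_setD1 mem_users_merged_Some => /= bU.
by exists (val b); rewrite ?(valP b).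
Qed.

Lemma tijs_merged :
  [/\ tijs q' None <= \sum_(b in L) tijs q b,
      (forall t, (#|users TP t :&: L| <= 1)%N) ->
        tijs q' None = \sum_(b in L) tijs q b &
      forall t, 0 < w t -> (2 <= #|users TP t :&: L|)%N ->
        tijs q' None < \sum_(b in L) tijs q b].
Proof.
have qE := quotient_coverage T w P.
have [be []] := tijs_coverage TP w_ge0; rewrite -qE => /andP[be0 _] eD tE.
have [be' []] := tijs_coverage TQ w_ge0.
rewrite -(quotient_coverage T w (merged P a)) => /andP[be'0 _] eD' tE'.
pose X := \sum_(b in L) (q [set b] - separable_cost q b).
pose X' := q L - \sum_(b in L) separable_cost q b.
pose Y := \sum_(b < A | (a <= b)%N) (q [set b] - separable_cost q b).
have split_sum (f : 'I_A -> R) :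
    \sum_b f b = \sum_(b in L) f b + \sum_(b < A | (a <= b)%N) f b.
  rewrite (bigID (mem L)); congr (_ + _); apply: eq_bigl => b.
  by rewrite /= inE -leqNgt.
have sep_ge0 b : 0 <= q [set b] - separable_cost q b.
  by rewrite subr_ge0 qE separable_le.
have X'0 : 0 <= X'.
  rewrite subr_ge0 qE -{2}(set0U L) -[leLHS]add0r -{1}(coverage_cost0 TP w).
  by rewrite coverage_add_separable// -setI_eq0 set0I.
have XE : X = \sum_(b in L) q [set b] - \sum_(b in L) separable_cost q b.
  by rewrite /X sumrB.
have X'X : X' <= X by rewrite XE lerB// qE coverage_le_sum.
have Y0 : 0 <= Y by apply: sumr_ge0 => b _.
(* Bring the equations for [be] and [be'] to the forms [be * (X + Y) = D] and [be' * (X' + Y) = D]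
   with the same [D]. *)
rewrite split_sum in eD.
rewrite (@sum_option_sig _ _ _ _ (fun b => q [set b] - separable_cost q b))
  in eD'; last first.
  by move=> b; rewrite quotient_merged_Some separable_merged_Some.
rewrite (@sum_option_sig _ _ _ _ (separable_cost q)) in eD'; last first.
  exact: separable_merged_Some.
rewrite quotient_mergedT quotient_merged_None separable_merged_None
  -split_sum in eD'.
have [le eq lt] := nonseparable_share_merge be0 be'0 X'0 X'X Y0 eD eD'.
rewrite tE' quotient_merged_None separable_merged_None.
have -> : \sum_(b in L) tijs q b = \sum_(b in L) separable_cost q b + be * X.
  by rewrite mulr_sumr -big_split; apply: eq_bigr => b _; rewrite tE.
split; first by rewrite lerD2l.
  move=> U1; congr (_ + _); apply: eq; rewrite XE; congr (_ - _).
  rewrite qE coverage_costE coverage_sum1.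
  apply: eq_bigr => t _; congr (_ *+ _).
  by rewrite -card_gt0; case: #|_| (U1 t) => [|[]].
(* The section [t] gives [X' < X]; its outside user [b], for whom [t] is not exclusive, gives
   [0 < Y] and [0 < D]. *)
move=> t wt U2; rewrite ltrD2l; have [b ab bU] := shared_in_alliance U2.
have sep_gt0 : 0 < q [set b] - separable_cost q b.
  rewrite subr_gt0 qE (separable_lt _ wt)//; apply: contraTneq U2 => ->.
  by rewrite -ltnNge ltnS (leq_trans (subset_leq_card (subsetIl _ _)))// cards1.
apply: lt.
- rewrite XE ltrD2r qE; exact: coverage_lt_sum wt U2.
- by rewrite /Y (bigD1 b)//= ltr_wpDr// sumr_ge0.
(* Replacing the separable cost of [b] by its larger stand-alone cost still keeps the sum below the
   total cost. *)
- rewrite subr_gt0 (lt_le_trans _ (_ : q [set b] + \sum_(j in ~: [set b])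
      separable_cost q j <= _))//.
    rewrite (bigD1 b)//= ltr_leD//; first by rewrite -subr_gt0.
    by rewrite (eq_bigl (mem (~: [set b])))// => j; rewrite /= !inE.
  by rewrite -(setUCr [set b]) qE coverage_add_separable// disjoints1 !inE eqxx.
Qed.

End Merge.

(** * From coverage games back to the highway problem *)

Lemma coalitional_structure_disjoint (N M : finType) (P : M -> {set N})
    (b b' : M) :
  coalitional_structure P -> b != b' -> [disjoint P b & P b'].
Proof.
case=> injP /and3P[_ /trivIsetP tI _] bb'.
by apply: tI; rewrite ?imset_f// inj_eq.
Qed.

Lemma merged_disjoint (N : finType) (A : nat) (P : 'I_A -> {set N}) (a : nat) :
  (forall b b', b != b' -> [disjoint P b & P b']) ->
  forall u u', u != u' -> [disjoint merged P a u & merged P a u'].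
Proof.
move=> dP; have dSN (b : {b : 'I_A | (a <= b)%N}) :
    [disjoint P (val b) & alliance P a].
  apply: bigcup_disjoint => b' b'a; apply: dP.
  by apply: contraTneq b'a => <-; rewrite -leqNgt (valP b).
case=> [b|] [b'|]//= bb'; [|exact: dSN|by rewrite disjoint_sym; exact: dSN].
by apply: dP; apply: contraNneq bb' => /val_inj ->.
Qed.

Theorem proposition3p5 (R : realType) (N : finType) (d : Order.disp_t)
    (K : finOrderType d) (G : highway R N K)
    (A : nat) (P : 'I_A -> {set N}) (hP : coalitional_structure P)
    (a : nat) (ha2 : (2 <= a)%N) (haA : (a <= A)%N)
    (hKse : newly_exclusive_sections G P (merged P a) = set0) :
  union_payment (highway_game G) (merged P a) None
    <= \sum_(b < A | (b < a)%N) union_payment (highway_game G) P b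
  /\
  ((forall t : K, 0 < section_cost G t) ->
   (union_payment (highway_game G) (merged P a) None
      < \sum_(b < A | (b < a)%N) union_payment (highway_game G) P b
    <->
    (exists (t : K) (b : 'I_A),
       [/\ (a <= b)%N, union_uses G (alliance P a) t & union_uses G (P b) t])
    /\
    (exists t : K,
       (2 <= #|[set b in unions_using G P t | (b < a)%N]|)%N))).
Proof.
set w := section_cost G; set T := sections_used G.
have w0 : forall t, 0 <= w t := section_cost_ge0 G.
have dP b b' := @coalitional_structure_disjoint _ _ P b b' hP.
have -> : highway_game G = coverage_cost T w by [].
pose TP b := \bigcup_(i in P b) T i.
have noK t : (2 <= #|users TP t|)%N ->
    #|users (fun u => \bigcup_(i in merged P a u) T i) t| != 1%N.
  move=> U2; apply/negP => U1; have /setP/(_ t) := hKse.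
  by rewrite !inE => /negP; apply; rewrite U1 andbT.
have [le eq lt] := tijs_merged w0 noK.
have inL t : #|users TP t :&: [set b : 'I_A | (b < a)%N]|
    = #|[set b in unions_using G P t | (b < a)%N]|.
  by apply: eq_card => b; rewrite !inE.
rewrite (union_payment_tijs T w0 (merged_disjoint (a := a) dP)).
have -> : \sum_(b < A | (b < a)%N) union_payment (coverage_cost T w) P b
    = \sum_(b in [set b : 'I_A | (b < a)%N])
        tijs (quotient_game (coverage_cost T w) P) b.
  by apply: eq_big => [b|b _]; rewrite ?inE// (union_payment_tijs T w0 dP).
split=> // wp; split=> [strict|[_ [t U2]]]; last first.
  by apply: (lt t); rewrite ?wp ?inL.
have [t U2] : exists t, (2 <= #|[set b in unions_using G P t | (b < a)%N]|)%N.
  (* With no section shared inside the alliance, [eq] turns the strict inequality into [x < x]. *)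
  apply: contrapT => no; move: strict; rewrite eq ?ltxx// => t.
  by rewrite inL leqNgt; apply/negP => U2; apply: no; exists t.
split; last by exists t.
(* The same section also has a user outside the alliance, so it witnesses both conditions. *)
rewrite -inL in U2; have [b ab bU] := shared_in_alliance noK U2.
exists t, b; split=> //; last by move: bU; rewrite inE.
have : None \in users (fun u => \bigcup_(i in merged P a u) T i) t.
  by rewrite mem_users_merged_None -card_gt0 (leq_trans _ U2).
by rewrite inE.
Qed.
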